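(* Let $F_i=(f_i=0)$ and $G_i=(g_i=0)$, $i=1,\dots,4$, be hyperplanes in $\mathbb{P}^4$ (over $\mathbb{C}$) and $H=(h=0)$ a hyperplane such that $h=f_i+g_i$ for $i=1,\dots,4$, and assume that the configuration is general in the sense that the linear forms $h,f_1,f_2,f_3,f_4$ are linearly independent. Let $X\subset\mathbb{P}^4$ be the cubic threefold $$X:\quad \frac{f_1f_2f_3f_4-g_1g_2g_3g_4}{h}=0 .$$ Then $X$ is projectively equivalent to the Segre cubic primal $$\mathfrak{S}_3=\left\{x_0+\cdots+x_5=0,\quad x_0^3+\cdots+x_5^3=0\right\}\subset\mathbb{P}^5 .$$ Consequently, the fifteen planes $$\Pi_{ij}=F_i\cap G_j\ (i\ne j,\ 1\le i,j\le 4),\qquad M_{12|34},\ M_{13|24},\ M_{14|23}$$ are precisely the fifteen planes on the Segre cubic; that is, they are pairwise distinct and are exactly the planes contained in $X$, corresponding under the projective equivalence to the fifteen planes contained in $\mathfrak{S}_3$.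
   Context: The relation $h=f_i+g_i$ is the normalized form of the condition that the four diagonal planes $F_i\cap G_i$ lie in the hyperplane $H$. The form $f_1f_2f_3f_4-g_1g_2g_3g_4$ is divisible by $h$. The planes $M$ are defined by $M_{12|34}:\ f_1+f_2=h,\ f_3+f_4=h$; $M_{13|24}:\ f_1+f_3=h,\ f_2+f_4=h$; $M_{14|23}:\ f_1+f_4=h,\ f_2+f_3=h$. A plane is a 2-dimensional linear subspace. Projective equivalence: $\mathfrak{S}_3$ is viewed as a cubic hypersurface in the hyperplane $\{x_0+\cdots+x_5=0\}\cong\mathbb{P}^4$, and the equivalence is a linear isomorphism of $\mathbb{P}^4$ with this hyperplane carrying $X$ onto $\mathfrak{S}_3$. *)

(* Defs.v *)
From HB Require Import structures.
From mathcomp Require Import all_boot all_order all_algebra.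
From mathcomp Require Import classical_sets reals complex.
From mathcomp Require Import mpoly.

Set Implicit Arguments.
Unset Strict Implicit.
Unset Printing Implicit Defensive.

Import GRing.Theory.
Local Open Scope ring_scope.

(* The points of P^(n-1) over K are given by homogeneous coordinates, i.e. by *)
(* nonzero vectors of 'rV[K]_n.  A d-dimensional linear subspace of P^(n-1)   *)
(* is a vector subspace of 'rV[K]_n of dimension d + 1, so the hyperplane     *)
(* (l = 0) is lker l, for l a nonzero linear form.                            *)

Section ProjectiveGeometry.

Variable K : fieldType.

Definition linform (n : nat) := 'Hom('rV[K]_n, K^o).

Definition form_poly (n : nat) (l : linform n) : {mpoly K[n]} :=
  \sum_(i < n) (l (delta_mx 0 i) : K) *: 'X_i.

(* The defining equations are meant to be homogeneous, so that the locus is   *)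
(* stable under rescaling of the coordinates.                                 *)
Definition zero_locus (n : nat) (ps : seq {mpoly K[n]}) : set 'rV[K]_n :=
  [set v : 'rV[K]_n | v != 0 /\ (forall p, p \in ps -> p.@[v 0] = 0)]%classic.

Definition is_plane_in (n : nat) (P : {vspace 'rV[K]_n}) (S : set 'rV[K]_n) :=
  \dim P = 3%N /\ (forall v : 'rV[K]_n, v \in P -> v != 0 -> S v).

Definition segre_hyperplane_eq : {mpoly K[6]} := \sum_(i < 6) 'X_i.

Definition segre_cubic_eq : {mpoly K[6]} := \sum_(i < 6) 'X_i ^+ 3.

Definition segre_cubic : set 'rV[K]_6 :=
  zero_locus [:: segre_hyperplane_eq; segre_cubic_eq].

(* p \o phi as a polynomial in the source coordinates *)
Definition pullback (m n : nat) (phi : 'Hom('rV[K]_m, 'rV[K]_n))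
    (p : {mpoly K[n]}) : {mpoly K[m]} :=
  p \mPo [tuple \sum_(j < m) (phi (delta_mx 0 j) 0 i) *: 'X_j | i < n].

(* phi induces a linear isomorphism of P^4 with the hyperplane                *)
(* x_0 + ... + x_5 = 0 of P^5 carrying the cubic hypersurface (q = 0) onto    *)
(* the Segre cubic, both as a set of points (a point of the image may be      *)
(* given by any of its homogeneous coordinates, scalars being absorbed by the *)
(* source) and as a hypersurface, i.e. at the level of equations.             *)
Definition segre_equivalence (q : {mpoly K[5]})
    (phi : 'Hom('rV[K]_5, 'rV[K]_6)) : Prop :=
  [/\ lker phi = 0%VS,
      forall y : 'rV[K]_6,
        y \in limg phi <-> segre_hyperplane_eq.@[y 0] = 0,
      (phi @` zero_locus [:: q])%classic = segre_cubic
    & exists2 c : K, c != 0 & pullback phi segre_cubic_eq = c *: q].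

Definition plane_Pi (f g : 'I_4 -> linform 5) (i j : 'I_4) :
  {vspace 'rV[K]_5} := (lker (f i) :&: lker (g j))%VS.

Definition plane_M (h : linform 5) (f : 'I_4 -> linform 5) (i j k l : 'I_4) :
  {vspace 'rV[K]_5} :=
  (lker (f i + f j - h) :&: lker (f k + f l - h))%VS.

(* The indices 1, ..., 4 are shifted to 0, ..., 3. *)
Definition fifteen_planes (h : linform 5) (f g : 'I_4 -> linform 5) :
  seq {vspace 'rV[K]_5} :=
  let o0 : 'I_4 := @Ordinal 4 0 isT in
  let o1 : 'I_4 := @Ordinal 4 1 isT in
  let o2 : 'I_4 := @Ordinal 4 2 isT in
  let o3 : 'I_4 := @Ordinal 4 3 isT in
  [seq plane_Pi f g ij.1 ij.2 | ij <- enum {: 'I_4 * 'I_4} & ij.1 != ij.2]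
  ++ [:: plane_M h f o0 o1 o2 o3; plane_M h f o0 o2 o1 o3;
         plane_M h f o0 o3 o1 o2].

End ProjectiveGeometry.

Arguments segre_cubic {K}.

(* Main.v *)
Require Import Defs.
From HB Require Import structures.
From mathcomp Require Import all_boot all_order all_algebra.
From mathcomp Require Import classical_sets reals complex.
From mathcomp Require Import mpoly.
From mathcomp Require Import fingroup perm ring.

(** Write e_k for the elementary symmetric functions of f_1, ..., f_4.  Since
    g_i = h - f_i, dividing by h gives
    q = e_3 - h e_2 + h^2 e_1 - h^3, and this is the only quotient because
    polynomials form a domain.  Put a_i = f_i - g_i = 2 f_i - h and
    s = a_1 + ... + a_4; then 8 q = e_3(a) + h^2 s.  The six forms
    a_i - s/2, s/2 + h, s/2 - h have sum 0, and their cubes have sum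
    3 (e_3(a) + h^2 s) = 24 q.  In terms of f and h they are the
    2 f_i - e_1 + h, e_1 - h and e_1 - 3 h of [segre_coord].  As the forms
    h, f_1, ..., f_4 are coordinates on the source, these six forms define an
    isomorphism onto the hyperplane x_0 + ... + x_5 = 0, hence the equivalence
    ([segre_map_equivalence]).

    The substance of the rest is that a plane in the Segre cubic is given by
    splitting the six coordinates into three pairs of opposite ones
    ([isotropic_subspace_involution]).  Let W be a 3-dimensional space on
    which the sum and the sum of cubes of the coordinates vanish.  Polarizing,
    sum_i u_i v_i w_i = 0 on W.  Three of the coordinates form a basis of the
    dual of W; in the dual basis of W the other three coordinates are the
    columns m_b of a matrix M, and the polarized equation reads
    sum_b m_b (x) m_b (x) m_b = - sum_a e_a (x) e_a (x) e_a.  Such a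
    decomposition of a tensor into cubes of independent vectors is essentially
    unique, which together with sum_b m_b = - sum_a e_a forces M to be minus a
    permutation matrix ([cubes_decomposition_unique]).  Nothing here is
    special to 3 and 6, so it is done for n-dimensional W in a space of
    dimension 2n.

    Given a plane in X, look at the partners of e_1 - h and e_1 - 3 h in the
    pairing.  If they are 2 f_i - e_1 + h and 2 f_j - e_1 + h, the two vanishing
    sums are 2 f_i and - 2 g_j, and the plane is F_i meet G_j.  If e_1 - h and
    e_1 - 3 h are paired together, e_1 = 2 h on the plane, and the partner of
    2 f_1 - e_1 + h tells which of the planes M it is
    ([plane_in_fifteen]).  That the fifteen planes are distinct is seen on
    points with prescribed values of h and the f_i.  Finally any equivalence is
    injective with image the hyperplane, so it matches the planes of X with
    those of the Segre cubic ([image_planes]). *)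

Set Implicit Arguments.
Unset Strict Implicit.
Unset Printing Implicit Defensive.

Import GRing.Theory.
Local Open Scope ring_scope.
Local Open Scope complex_scope.

(** * Spaces on which the sum and the sum of cubes of the coordinates vanish *)

(** Some n of the coordinate functions restrict to a basis of the dual of W,
    because a matrix whose rows form a basis of W has an invertible n x n minor;
    B is the dual basis of W. *)
Lemma dual_coordinates (K : fieldType) m n (W : {vspace 'rV[K]_m}) :
    \dim W = n ->
  exists (s : 'I_n -> 'I_m) (B : 'M[K]_(n, m)),
    [/\ injective s, forall a, row a B \in W,
        forall a b, B a (s b) = (a == b)%:R
      & forall v : 'rV_m, v \in W ->
          forall i, v 0 i = \sum_a v 0 (s a) * B a i].
Proof.
move=> dimW; case: n / dimW.
set A := \matrix_(a < \dim W) (vbasis W)`_a.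
have rowA a : row a A = (vbasis W)`_a by rewrite rowK.
have Afree : row_free A.
  apply: inj_row_free => v; rewrite mulmx_sum_row => v0.
  have /freeP := basis_free (vbasisP W).
  move=> /(_ (fun a => v 0 a)) fr; apply/rowP=> a; rewrite mxE; apply: fr.
  by rewrite -[RHS]v0; apply: eq_bigr => b _; rewrite rowA.
have Afull : row_full A^T by rewrite /row_full mxrank_tr.
pose s := fullrankfun Afull.
pose N := colsub s A.
have Nunit : N \in unitmx.
  by rewrite -unitmx_tr /N trmx_mxsub; apply: fullrowsub_unit.
pose B := invmx N *m A.
have Bs a b : B a (s b) = (a == b)%:R.
  transitivity ((invmx N *m N) a b); last by rewrite mulVmx // mxE.
  by rewrite !mxE; apply: eq_bigr => k _; rewrite !mxE.
exists s, B; split=> // [|a|v vW j]; first exact: fullrankfun_inj.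
  rewrite row_mul mulmx_sum_row memv_suml // => b _.
  by rewrite memvZ // rowA vbasis_mem // mem_nth // size_tuple.
have [c vE] : exists c : 'rV_(\dim W), v = c *m B.
  exists (\row_a (coord (vbasis W) a v) *m N).
  rewrite mulmxA mulmxK // mulmx_sum_row {1}(coord_vbasis vW).
  by apply: eq_bigr => a _; rewrite mxE rowA.
have cE a : v 0 (s a) = c 0 a.
  rewrite vE mxE (bigD1 a) //= Bs eqxx mulr1 big1 ?addr0 // => b ba.
  by rewrite Bs (negPf ba) mulr0.
by rewrite vE mxE -vE; apply: eq_bigr => a _; rewrite cE.
Qed.

Lemma extend_injection n k (s : 'I_n -> 'I_(n + k)) : injective s ->
  exists p : 'S_(n + k), forall a, p (lshift k a) = s a.
Proof.
move=> s_inj.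
pose C := [predC (mem (codom s))].
have cardC : k = #|C|.
  rewrite -[LHS](addKn n) -[in LHS](card_ord (n + k)).
  by rewrite -(cardC (mem (codom s))) card_codom // card_ord addKn.
pose F i := match split i with
  | inl a => s a | inr b => enum_val (cast_ord cardC b) end.
have F_inj : injective F.
  have Cs a b : s a <> enum_val (cast_ord cardC b).
    move=> e; have := enum_valP (cast_ord cardC b).
    by rewrite -e inE /= codom_f.
  move=> i j; rewrite /F; case: splitP => a ia; case: splitP => b jb.
  - by move=> /s_inj ab; apply: val_inj; rewrite /= ia jb ab.
  - by move/Cs.
  - by move/esym/Cs.
  - move=> /enum_val_inj/cast_ord_inj ab.
    by apply: val_inj; rewrite /= ia jb ab.
exists (perm F_inj) => a; rewrite permE /F.
by rewrite -[lshift k a]/(unsplit (inl a)) unsplitK.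
Qed.

Lemma polarize_cubes (K : fieldType) (I : finType) (u v w : I -> K) :
    6%:R != 0 :> K ->
    (forall a b c : bool,
      \sum_i (u i *+ a + v i *+ b + w i *+ c) ^+ 3 = 0) ->
  \sum_i u i * v i * w i = 0.
Proof.
move=> n6 S; apply: (mulfI n6); rewrite mulr0 mulr_sumr.
transitivity (\sum_i (u i *+ true + v i *+ true + w i *+ true) ^+ 3
  - \sum_i (u i *+ true + v i *+ true + w i *+ false) ^+ 3
  - \sum_i (u i *+ true + v i *+ false + w i *+ true) ^+ 3
  - \sum_i (u i *+ false + v i *+ true + w i *+ true) ^+ 3
  + \sum_i (u i *+ true + v i *+ false + w i *+ false) ^+ 3
  + \sum_i (u i *+ false + v i *+ true + w i *+ false) ^+ 3
  + \sum_i (u i *+ false + v i *+ false + w i *+ true) ^+ 3).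
  rewrite -!sumrB -!big_split; apply: eq_bigr => i _ /=; ring.
by rewrite !S; ring.
Qed.

(** The cubic condition says that the sum of the cubes (in the tensor sense) of
    the columns of M is minus the sum of the cubes of the standard basis.
    Contracting it with the vector (1, ..., 1) shows that M is invertible, and
    contracting it with e_a turns row a of M into a matrix of rank one which is
    diagonal, so that the row has a single nonzero entry. *)
Lemma cubes_decomposition_unique (K : fieldType) n (M : 'M[K]_n) :
    (forall a, \sum_b M a b = -1) ->
    (forall a c d,
      \sum_b M a b * M c b * M d b = - ((a == c) && (a == d))%:R) ->
  exists2 t : 'I_n -> 'I_n, injective t
    & forall a b, M a (t b) = - (a == b)%:R.
Proof.
move=> M1 M3.
(* N is the right inverse of M found by contracting with (1, ..., 1). *)
pose N := - (diag_mx (\row_b \sum_a M a b) *m M^T).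
have MN : M *m N = 1%:M.
  apply/matrixP=> c d; rewrite mulmxN mul_diag_mx 3!mxE.
  transitivity (- \sum_b \sum_a M a b * M c b * M d b).
    congr (- _); apply: eq_bigr => b _; rewrite !mxE mulr_suml mulr_sumr.
    by apply: eq_bigr => a _; rewrite mulrCA mulrA.
  rewrite exchange_big /= -sumrN (bigD1 c) //= M3 eqxx /= opprK.
  by rewrite big1 ?addr0 // => a ac; rewrite M3 (negPf ac) oppr0 oppr0.
have {MN} NM := mulmx1C MN; clearbody N.
(* Contracting with e_a: M D M^T = - E_aa, hence D = - N E_aa N^T. *)
have MaN a j k : M a j *+ (j == k) = - (N j a * N k a).
  pose D := diag_mx (row a M).
  have MDM : M *m D *m M^T = - delta_mx a a.
    apply/matrixP=> c d; rewrite mul_mx_diag !mxE.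
    transitivity (\sum_b M a b * M c b * M d b).
      by apply: eq_bigr => b _; rewrite !mxE [M a b * _]mulrC.
    by rewrite M3 !(eq_sym a).
  have : D = - (N *m delta_mx a a *m N^T).
    rewrite -mulNmx -mulmxN -MDM !mulmxA NM mul1mx.
    by rewrite -mulmxA -trmx_mul NM trmx1 mulmx1.
  move=> /matrixP/(_ j k); rewrite !mxE => ->; congr (- _).
  rewrite (bigD1 a) //= big1 ?addr0 => [|b ba]; last first.
    rewrite mxE big1 ?mul0r // => c _.
    by rewrite !mxE (negPf ba) andbF mulr0.
  rewrite !mxE (bigD1 a) //= big1 ?addr0 => [|c ca]; last first.
    by rewrite !mxE (negPf ca) mulr0.
  by rewrite mxE !eqxx mulr1.
have Morth a j k : j != k -> M a j * M a k = 0.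
  move=> jk; have := MaN a j k; rewrite (negPf jk) => /eqP.
  rewrite eq_sym oppr_eq0 mulf_eq0.
  have := MaN a j j; have := MaN a k k; rewrite !eqxx !mulr1n => -> ->.
  by case/orP=> /eqP->; rewrite !(mul0r, oppr0, mulr0).
have [t tP] : exists t : 'I_n -> 'I_n,
    forall a, M a (t a) = -1 /\ (forall k, k != t a -> M a k = 0).
  apply: (@fin_all_exists _ (fun=> 'I_n) (fun a j =>
    M a j = -1 /\ (forall k, k != j -> M a k = 0))) => a.
  have [/existsP[j Mj]|] := boolP [exists j, M a j != 0]; last first.
    move/existsPn=> M0; have /eqP := M1 a.
    rewrite big1 => [|b _]; last by apply/eqP; rewrite -[_ == _]negbK M0.
    by rewrite eq_sym oppr_eq0 oner_eq0.
  have Mk k : k != j -> M a k = 0.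
    by move=> /(Morth a)/eqP; rewrite mulf_eq0 (negPf Mj) orbF => /eqP.
  by exists j; split=> //; rewrite -(M1 a) (bigD1 j) //= big1 ?addr0.
(* For a <> b, the relation for the indices b, b, a reduces to M a (t b) = 0,
   as row b of M is concentrated at t b. *)
have Mt a b : M a (t b) = - (a == b)%:R.
  have [->|ab] := eqVneq a b; first by case: (tP b).
  have := M3 b b a; rewrite eqxx eq_sym (negPf ab) !oppr0 (bigD1 (t b)) //=.
  rewrite (tP b).1 mulrNN mul1r mul1r big1 ?addr0 // => k /(tP b).2->.
  by rewrite mul0r mul0r.
exists t => // a b tab; apply/eqP; have := Mt a b; rewrite -tab Mt eqxx.
by case: (a == b) => // /oppr_inj/eqP; rewrite oner_eq0.
Qed.

(** For n = 3 this classifies the planes in the Segre cubic: W satisfies the n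
    independent equations x_k + x_(sg k) = 0, and its dimension is n, so that
    they define W. *)
Lemma isotropic_subspace_involution (K : fieldType) n
    (W : {vspace 'rV[K]_(n + n)}) :
    6%:R != 0 :> K -> \dim W = n ->
    (forall v, v \in W -> \sum_i v 0 i = 0) ->
    (forall v, v \in W -> \sum_i v 0 i ^+ 3 = 0) ->
  exists sg : 'I_(n + n) -> 'I_(n + n), [/\ involutive sg, forall i, sg i != i
    & forall v, v \in W -> forall i, v 0 i + v 0 (sg i) = 0].
Proof.
move=> n6 dimW W1 W3.
have [s [B [s_inj BW Bs vB]]] := dual_coordinates dimW.
have [p ps] := extend_injection s_inj.
pose M := \matrix_(a < n, b < n) B a (p (rshift n b)).
have sumS (F : 'I_(n + n) -> K) :
    \sum_i F i = \sum_a F (s a) + \sum_b F (p (rshift n b)).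
  rewrite (reindex_inj (@perm_inj _ p)) big_split_ord /=; congr (_ + _).
  by apply: eq_bigr => a _; rewrite ps.
have M1 a : \sum_b M a b = -1.
  apply/eqP; rewrite -addr_eq0 addrC; apply/eqP.
  rewrite -[RHS](W1 _ (BW a)) sumS; congr (_ + _); last first.
    by apply: eq_bigr => b _; rewrite !mxE.
  rewrite (bigD1 a) //= mxE Bs eqxx big1 ?addr0 // => b ba.
  by rewrite mxE Bs eq_sym (negPf ba).
have M3 a c d :
    \sum_b M a b * M c b * M d b = - ((a == c) && (a == d))%:R.
  have : \sum_i B a i * B c i * B d i = 0.
    apply: polarize_cubes => // x y z.
    rewrite -[RHS](W3 (row a B *+ x + row c B *+ y + row d B *+ z)).
      by apply: eq_bigr => i _; rewrite !(mulmxnE, mxE).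
    by rewrite !(rpredD, rpredMn, BW).
  rewrite sumS (bigD1 a) //= !Bs eqxx big1 => [|b ba]; last first.
    by rewrite Bs eq_sym (negPf ba) !mul0r.
  rewrite addr0 mul1r -natrM mulnb !(eq_sym _ a) => /eqP.
  rewrite addrC addr_eq0 => /eqP <-.
  by apply: eq_bigr => b _; rewrite !mxE.
have [t t_inj Mt] := cubes_decomposition_unique M1 M3.
have vp b v : v \in W ->
    v 0 (p (lshift n b)) + v 0 (p (rshift n (t b))) = 0.
  move=> vW; rewrite ps [v 0 (p _)](vB v vW) (bigD1 b) //=.
  have BM c : B c (p (rshift n (t b))) = - (c == b)%:R by rewrite -Mt mxE.
  rewrite BM eqxx mulrN1 big1 ?addr0 ?subrr // => c cb.
  by rewrite BM (negPf cb) oppr0 mulr0.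
(* In the coordinates permuted by p, the left index a and the right index t a
   are partners. *)
pose swap (u : 'I_n + 'I_n) := match u with
  | inl a => inr (t a) | inr b => inl (invF t_inj b) end.
have swapK : involutive swap by case=> a /=; rewrite ?invF_f ?f_invF.
exists (fun i => p (unsplit (swap (split (p^-1 i)%g)))); split=> [i|i|v vW i].
- by rewrite permK unsplitK swapK splitK permKV.
- apply/eqP=> e; have := congr1 (@split n n) (canRL (permK p) e).
  by rewrite unsplitK; case: (split _).
- rewrite -{1}(permKV p i) -{1}(splitK (p^-1%g i)).
  case: (split _) => a /=; first exact: vp.
  by rewrite addrC -{2}(f_invF t_inj a); exact: vp.
Qed.

(** * Linear forms on K^n *)

Section LinearForms.
Variable K : fieldType.

(** Evaluation is made an additive map in order to push the values of the
    coordinates of [segre_coord] through it. *)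
Definition lfun_eval n (v : 'rV[K]_n) (l : linform K n) : K := l v.

Fact lfun_eval_is_zmod_morphism n (v : 'rV[K]_n) :
  zmod_morphism (lfun_eval v).
Proof. by move=> a b; rewrite /lfun_eval !lfunE /= lfunE. Qed.
HB.instance Definition _ n (v : 'rV[K]_n) :=
  GRing.isZmodMorphism.Build (linform K n) K (lfun_eval v)
    (lfun_eval_is_zmod_morphism v).

Fact form_poly_is_zmod_morphism n : zmod_morphism (@form_poly K n).
Proof.
move=> a b; rewrite /form_poly -sumrB; apply: eq_bigr => i _.
by rewrite -scalerBl !lfunE /= lfunE.
Qed.
HB.instance Definition _ n :=
  GRing.isZmodMorphism.Build (linform K n) {mpoly K[n]} (@form_poly K n)
    (@form_poly_is_zmod_morphism n).

Lemma meval_form_poly n (l : linform K n) (v : 'rV[K]_n) :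
  (form_poly l).@[v 0] = l v.
Proof.
rewrite [v in RHS]row_sum_delta linear_sum raddf_sum /=.
by apply: eq_bigr => i _; rewrite mevalZ mevalXU linearZ mulrC.
Qed.

Lemma form_poly_eq0 n (l : linform K n) : (form_poly l == 0) = (l == 0).
Proof.
apply/eqP/eqP => [l0|->]; last exact: raddf0.
by apply/lfunP=> v; rewrite -meval_form_poly l0 meval0 lfunE.
Qed.

Section FormsMap.
Variables (m n : nat) (l : 'I_m -> linform K n).
Definition forms_row (v : 'rV[K]_n) : 'rV[K]_m := \row_i (l i v : K).
Fact forms_row_is_linear : linear forms_row.
Proof. by move=> a u v; apply/rowP=> i; rewrite !mxE linearP. Qed.
HB.instance Definition _ :=
  GRing.isLinear.Build K 'rV[K]_n 'rV[K]_m _ forms_row forms_row_is_linear.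
Definition forms_map : 'Hom('rV[K]_n, 'rV[K]_m) := linfun forms_row.
Lemma forms_mapE v i : forms_map v 0 i = l i v.
Proof. by rewrite lfunE mxE. Qed.
End FormsMap.

(** n independent forms span the dual, so only 0 is killed by all of them. *)
Lemma lker_free_forms n (X : n.-tuple (linform K n)) : free X ->
  lker (forms_map (tnth X)) == 0%VS.
Proof.
move=> freeX; set L := forms_map _.
have Xfull : <<X>>%VS = fullv.
  apply/eqP; rewrite eqEdim subvf /= (eqP freeX) size_tuple dimvf.
  by rewrite [dim _]muln1 dim_matrix mul1r.
apply/lker0P=> u w /rowP Luw.
have XE (x : linform K n) : x u = x w.
  have /coord_span -> : x \in <<X>>%VS by rewrite Xfull memvf.
  rewrite !sum_lfunE; apply: eq_bigr => i _; rewrite !lfunE /=.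
  by have := Luw i; rewrite !forms_mapE !(tnth_nth 0) => ->.
rewrite (coord_vbasis (memvf u)) (coord_vbasis (memvf w)).
apply: eq_bigr => j _; congr (_ *: _).
by have := XE (linfun (coord (vbasis fullv) j : _ -> K^o)); rewrite !lfunE.
Qed.

Lemma free_forms_interpolation n (X : n.-tuple (linform K n)) : free X ->
  forall c : 'rV[K]_n, exists v, forall i, tnth X i v = c 0 i.
Proof.
move=> /lker_free_forms/lker0_limgf Lsurj c.
have /memv_imgP[v _ ->] : c \in limg (forms_map (tnth X)).
  by rewrite Lsurj memvf.
by exists v => i; rewrite forms_mapE.
Qed.

Lemma dim_cap_lker n (U : {vspace 'rV[K]_n}) (l : linform K n) u :
  u \in U -> l u != 0 -> \dim (U :&: lker l) = (\dim U).-1.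
Proof.
move=> uU lu; rewrite -(limg_ker_dim l U).
suff -> : \dim (l @: U) = 1%N by rewrite addn1.
apply/eqP; rewrite eqn_leq; apply/andP; split.
  by apply: leq_trans (dimvS (subvf _)) _; rewrite dimvf.
rewrite lt0n dimv_eq0; apply: contraNneq lu => l0.
by have := memv_img l uU; rewrite l0 memv0.
Qed.

Lemma dim_cap2_lker n (a b : linform K n) u w :
  a u != 0 -> w \in lker a -> b w != 0 -> \dim (lker a :&: lker b) = n.-2.
Proof.
move=> au wa bw; rewrite (dim_cap_lker wa bw) -(capfv (lker a)).
by rewrite (dim_cap_lker (memvf u) au) dimvf [dim _]dim_matrix mul1r.
Qed.

Lemma is_plane_eq n (P Q : {vspace 'rV[K]_n}) :
  \dim P = 3 -> \dim Q = 3 -> {subset P <= Q} -> P = Q.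
Proof.
by move=> dP dQ /subvP PQ; apply/eqP; rewrite eqEdim PQ dP dQ.
Qed.

End LinearForms.

(** * The cubic form and its Segre coordinates *)

Local Notation o0 := (@Ordinal 4 0 isT).
Local Notation o1 := (@Ordinal 4 1 isT).
Local Notation o2 := (@Ordinal 4 2 isT).
Local Notation o3 := (@Ordinal 4 3 isT).

Lemma ord4_ind (P : 'I_4 -> Prop) :
  P o0 -> P o1 -> P o2 -> P o3 -> forall i, P i.
Proof.
move=> P0 P1 P2 P3 [[|[|[|[|//]]]] i4].
- by rewrite (_ : Ordinal i4 = o0) //; apply: val_inj.
- by rewrite (_ : Ordinal i4 = o1) //; apply: val_inj.
- by rewrite (_ : Ordinal i4 = o2) //; apply: val_inj.
- by rewrite (_ : Ordinal i4 = o3) //; apply: val_inj.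
Qed.

Lemma big_ord4 (T : Type) (idx : T) (op : Monoid.law idx) (F : 'I_4 -> T) :
  \big[op/idx]_(i < 4) F i = op (op (op (F o0) (F o1)) (F o2)) (F o3).
Proof.
rewrite !big_ord_recr big_ord0 Monoid.mul1m.
by congr (op (op (op (F _) (F _)) (F _)) (F _)); apply: val_inj.
Qed.

(** This is e_3 - h e_2 + h^2 e_1 - h^3, for the elementary symmetric functions
    e_k of f. *)
Definition cubic_quotient (A : comNzRingType) (h : A) (f : 'I_4 -> A) : A :=
  f o0 * f o1 * f o2 + f o0 * f o1 * f o3 + f o0 * f o2 * f o3
    + f o1 * f o2 * f o3
  - h * (f o0 * f o1 + f o0 * f o2 + f o0 * f o3 + f o1 * f o2 + f o1 * f o3
         + f o2 * f o3)
  + h ^+ 2 * (f o0 + f o1 + f o2 + f o3) - h ^+ 3.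

Lemma cubic_quotientE (A : comNzRingType) (h : A) (f : 'I_4 -> A) :
  h * cubic_quotient h f = \prod_(i < 4) f i - \prod_(i < 4) (h - f i).
Proof. by rewrite !big_ord4 /= /cubic_quotient; ring. Qed.

Lemma rmorph_cubic_quotient (A B : comNzRingType) (phi : {rmorphism A -> B})
    (h : A) (f : 'I_4 -> A) :
  phi (cubic_quotient h f) = cubic_quotient (phi h) (phi \o f).
Proof.
by rewrite /cubic_quotient /= !(rmorphD, rmorphN, rmorphM, rmorphXn).
Qed.

(** The six forms whose cubes add up to 24 times the cubic.  They are defined
    over any abelian group so as to make sense for linear forms, for the
    polynomials they give, and for their values at a point. *)
Definition segre_coord (V : zmodType) (h : V) (f : 'I_4 -> V)
    (k : 'I_(4 + 2)) : V :=
  let e := \sum_(i < 4) f i in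
  match split k with
  | inl i => f i + f i - e + h
  | inr j => if j == ord0 then e - h else e - h - h - h
  end.

Lemma raddf_segre_coord (U V : zmodType) (phi : {additive U -> V}) (h : U)
    (f : 'I_4 -> U) (k : 'I_(4 + 2)) :
  phi (segre_coord h f k) = segre_coord (phi h) (phi \o f) k.
Proof.
rewrite /segre_coord; case: (split k) => [i|j].
  by rewrite !(raddfD, raddfN) raddf_sum.
by case: ifP => _; rewrite !(raddfD, raddfN) raddf_sum.
Qed.

Lemma segre_coord_lshift (V : zmodType) (h : V) f i :
  segre_coord h f (lshift 2 i) = f i + f i - \sum_(i < 4) f i + h.
Proof.
by rewrite /segre_coord -[lshift 2 i]/(unsplit (inl i)) unsplitK.
Qed.

Lemma segre_coord_rshift (V : zmodType) (h : V) f j :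
  segre_coord h f (rshift 4 j) =
  if j == ord0 then \sum_(i < 4) f i - h else \sum_(i < 4) f i - h - h - h.
Proof.
by rewrite /segre_coord -[rshift 4 j]/(unsplit (inr j)) unsplitK.
Qed.

Lemma sum_segre_coord (A : comNzRingType) (h : A) (f : 'I_4 -> A)
    (F : A -> A) :
  \sum_(k < 6) F (segre_coord h f k) =
    let e := f o0 + f o1 + f o2 + f o3 in
    F (f o0 + f o0 - e + h) + F (f o1 + f o1 - e + h) + F (f o2 + f o2 - e + h)
    + F (f o3 + f o3 - e + h) + F (e - h) + F (e - h - h - h).
Proof.
rewrite (@big_split_ord _ _ _ 4 2) /= big_ord4 big_ord_recl big_ord1 /=.
by rewrite !segre_coord_rshift !segre_coord_lshift !big_ord4 /= addrA.
Qed.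

Lemma segre_coord_sum (A : comNzRingType) (h : A) (f : 'I_4 -> A) :
  \sum_(k < 6) segre_coord h f k = 0.
Proof. by rewrite (sum_segre_coord h f id) /=; ring. Qed.

Lemma segre_coord_sum_cubes (A : comNzRingType) (h : A) (f : 'I_4 -> A) :
  \sum_(k < 6) segre_coord h f k ^+ 3 = 24%:R * cubic_quotient h f.
Proof.
by rewrite (sum_segre_coord h f (fun x => x ^+ 3)) /= /cubic_quotient; ring.
Qed.

(** * The configuration of hyperplanes *)

Section Configuration.
Variables (K : fieldType) (h : linform K 5) (f g : 'I_4 -> linform K 5).
Hypothesis char6 : 6%:R != 0 :> K.
Hypothesis hfg : forall i : 'I_4, h = f i + g i.
Hypothesis hgen : free (h :: [seq f i | i <- enum 'I_4]).

Let char2 : 2%:R != 0 :> K.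
Proof. by apply: contraNneq char6 => e; rewrite (natrM _ 2 3) e mul0r. Qed.

Fact size_config : size (h :: [seq f i | i <- enum 'I_4]) == 5.
Proof. by rewrite /= size_map size_enum_ord. Qed.
Let X : 5.-tuple (linform K 5) := Tuple size_config.

Let X_h : tnth X ord0 = h.
Proof. by rewrite (tnth_nth 0). Qed.

Let X_f i : tnth X (lift ord0 i) = f i.
Proof.
by rewrite (tnth_nth 0) /= add0n (nth_map i) ?size_enum_ord // nth_ord_enum.
Qed.

Lemma config_point (c0 : K) (c : 'I_4 -> K) :
  exists v, h v = c0 /\ forall i, f i v = c i.
Proof.
have [v vX] := @free_forms_interpolation K 5 X hgen
  (\row_i (if unlift ord0 i is Some j then c j else c0)).
exists v; split=> [|i]; first by rewrite -X_h vX mxE unlift_none.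
by rewrite -X_f vX mxE liftK.
Qed.

Lemma config_separates v : h v = 0 -> (forall i, f i v = 0) -> v = 0.
Proof.
move=> hv fv; apply: (lker0P (@lker_free_forms K 5 X hgen)).
rewrite linear0; apply/rowP=> i; rewrite forms_mapE mxE.
by case: (unliftP ord0 i) => [j|] ->; rewrite ?X_h ?X_f.
Qed.

Lemma gE i v : g i v = h v - f i v :> K.
Proof. by rewrite (hfg i) lfunE /= addrC addKr. Qed.

Lemma form_poly_h_neq0 : form_poly h != 0.
Proof.
rewrite form_poly_eq0; have [v [hv _]] := config_point 1 (fun=> 0).
by apply: contra_eq_neq hv => ->; rewrite lfunE eq_sym oner_eq0.
Qed.

Local Notation q := (cubic_quotient (form_poly h) (@form_poly K 5 \o f)).

(** Uniqueness of the quotient holds because polynomials over a field form an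
    integral domain. *)
Lemma quotient_unique (p : {mpoly K[5]}) :
  form_poly h * p
    = \prod_(i < 4) form_poly (f i) - \prod_(i < 4) form_poly (g i) <-> p = q.
Proof.
have <- : form_poly h * q
    = \prod_(i < 4) form_poly (f i) - \prod_(i < 4) form_poly (g i).
  rewrite cubic_quotientE; congr (_ - _); apply: eq_bigr => i _ /=.
  by rewrite (hfg i) raddfD /= addrC addKr.
by split=> [/(mulfI form_poly_h_neq0)|->].
Qed.

Lemma meval_q (v : 'rV[K]_5) :
  q.@[v 0] = cubic_quotient (h v : K) (fun i => f i v : K).
Proof.
rewrite rmorph_cubic_quotient /cubic_quotient /= !meval_form_poly.
by [].
Qed.

Lemma zero_locusE (v : 'rV[K]_5) : zero_locus [:: q] v <->
  v != 0 /\ cubic_quotient (h v : K) (fun i => f i v : K) = 0.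
Proof.
rewrite -meval_q; split=> -[v0 qv]; split=> //.
  by apply: qv; rewrite mem_head.
by move=> p; rewrite inE => /eqP->.
Qed.

Lemma mem_plane_Pi i j v :
  (v \in plane_Pi f g i j) = (f i v == 0) && (f j v == h v).
Proof.
by rewrite memv_cap !memv_ker gE subr_eq0 [h v == _]eq_sym.
Qed.

Lemma mem_plane_M i j k l v : (v \in plane_M h f i j k l) =
  (f i v + f j v == h v :> K) && (f k v + f l v == h v :> K).
Proof. by rewrite memv_cap !memv_ker !lfunE /= !lfunE !subr_eq0. Qed.

Lemma dim_plane_Pi i j : \dim (plane_Pi f g i j) = 3.
Proof.
have [u [_ fu]] := config_point 0 (fun=> 1).
have [w [hw fw]] := config_point 1 (fun=> 0).
by apply: (@dim_cap2_lker _ _ _ _ u w);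
  rewrite ?memv_ker ?gE ?fu ?fw ?hw ?subr0 ?oner_eq0.
Qed.

Lemma dim_plane_M i j k l : k \notin [:: i; j; l] ->
  \dim (plane_M h f i j k l) = 3.
Proof.
rewrite !inE !negb_or => /and3P[ki kj kl].
have [u [hu fu]] := config_point 1 (fun=> 0).
have [w [hw fw]] := config_point 0 (fun m => (m == k)%:R).
apply: (@dim_cap2_lker _ _ _ _ u w); rewrite ?memv_ker !lfunE /= !lfunE /=.
- by rewrite !fu hu add0r sub0r oppr_eq0 oner_eq0.
- by rewrite !fw hw ![_ == k]eq_sym (negPf ki) (negPf kj) addr0 subr0.
- by rewrite !fw hw eqxx [l == k]eq_sym (negPf kl) addr0 subr0 oner_eq0.
Qed.

Local Notation planes := (fifteen_planes h f g).

Lemma mem_fifteen_planes P : P \in planes <->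
  (exists i j, i != j /\ P = plane_Pi f g i j) \/
  P \in [:: plane_M h f o0 o1 o2 o3; plane_M h f o0 o2 o1 o3;
            plane_M h f o0 o3 o1 o2].
Proof.
rewrite /fifteen_planes mem_cat.
split=> [/orP[/mapP[[i j]]|]|[[i [j [ij ->]]]|]].
- by rewrite mem_filter => /andP[ij _] ->; left; exists i, j.
- by right.
- apply/orP; left; apply/mapP; exists (i, j) => //.
  by rewrite mem_filter ij mem_enum.
- by move=> PM; rewrite PM orbT.
Qed.

(** * The fifteen planes: distinctness, and inclusion in the cubic *)

Lemma size_fifteen_planes : size planes = 15.
Proof.
rewrite /fifteen_planes size_cat size_map /= size_filter -sum1_count.
rewrite big_enum_cond /=.
rewrite -(pair_big_dep xpredT (fun i j : 'I_4 => i != j) (fun _ _ => 1%N)) /=.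
rewrite (eq_bigr (fun=> 3)) => [|i _]; first by rewrite sum_nat_const card_ord.
rewrite sum1_card (eq_card (B := predC1 i)) ?cardC1 ?card_ord // => j.
by rewrite !inE eq_sym.
Qed.

(** The point with h = 1, f_i = 0 and the other f_m = 1 lies on the plane (i, j)
    and on no F_m with m <> i; the point with h = 1, f_j = 1 and the other
    f_m = 0 lies on it and on no G_m with m <> j. *)
Lemma plane_Pi_inj i j k l : i != j -> plane_Pi f g i j = plane_Pi f g k l ->
  i = k /\ j = l.
Proof.
move=> ij PE; split.
  have [v [hv fv]] := config_point 1 (fun m => (m != i)%:R).
  have : v \in plane_Pi f g i j.
    by rewrite mem_plane_Pi !fv hv eqxx [j == i]eq_sym ij !eqxx.
  rewrite PE mem_plane_Pi fv => /andP[]; case: (eqVneq k i) => //= _.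
  by rewrite oner_eq0.
have [v [hv fv]] := config_point 1 (fun m => (m == j)%:R).
have : v \in plane_Pi f g i j by rewrite mem_plane_Pi !fv hv (negPf ij) !eqxx.
rewrite PE mem_plane_Pi !fv hv => /andP[_]; case: (eqVneq l j) => //= _.
by rewrite eq_sym oner_eq0.
Qed.

(** The point with h = 0, f_i = 1, f_j = -1 and the other forms 0 separates the
    two planes. *)
Lemma plane_M_neq i j k l j' k' l' : uniq [:: i; j; k; l] ->
  j' \notin [:: i; j] -> plane_M h f i j k l != plane_M h f i j' k' l'.
Proof.
move=> /= /and4P[]; rewrite !inE !negb_or.
move=> /and3P[ij ik il] /andP[jk jl] _ _ /andP[j'i j'j].
have [v [hv fv]] := config_point 0 (fun m => (m == i)%:R - (m == j)%:R).
apply/eqP=> PE; have : v \in plane_M h f i j k l.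
  rewrite mem_plane_M !fv hv !eqxx [j == i]eq_sym [k == i]eq_sym.
  rewrite [l == i]eq_sym [k == j]eq_sym [l == j]eq_sym (negPf ij) (negPf ik).
  by rewrite (negPf il) (negPf jk) (negPf jl) !subr0 sub0r subrr addr0 eqxx.
rewrite PE mem_plane_M !fv hv eqxx (negPf ij) (negPf j'i) (negPf j'j).
by rewrite !subr0 addr0 oner_eq0.
Qed.

Lemma uniq_fifteen_planes : uniq planes.
Proof.
(* On the planes M the sum of the f_i is 2h, whereas the plane (i, j) has a
   point with h = 1 where this sum is 3. *)
have sumM P v : P \in [:: plane_M h f o0 o1 o2 o3; plane_M h f o0 o2 o1 o3;
      plane_M h f o0 o3 o1 o2] ->
    v \in P -> \sum_i lfun_eval v (f i) = h v + h v.
  rewrite big_ord4 /= /lfun_eval !inE => /or3P[] /eqP->;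
    by rewrite mem_plane_M => /andP[/eqP e1 /eqP e2]; rewrite -{1}e1 -e2; ring.
rewrite /fifteen_planes cat_uniq; apply/and3P; split.
- rewrite map_inj_in_uniq => [|[i j] [k l]].
    by rewrite filter_uniq // enum_uniq.
  rewrite !mem_filter /= => /andP[ij _] /andP[kl _] /(plane_Pi_inj ij).
  by case=> -> ->.
- apply/hasPn=> P PM; apply/mapP=> -[[i j]]; rewrite mem_filter /=.
  move=> /andP[ij _] PE.
  have [v [hv fv]] := config_point 1 (fun m => (m != i)%:R).
  have vP : v \in P.
    by rewrite PE mem_plane_Pi !fv hv eqxx [j == i]eq_sym ij !eqxx.
  have := sumM P v PM vP; rewrite hv /lfun_eval big_ord4 /= !fv.
  move=> /eqP; rewrite -subr_eq0 (_ : _ - _ = 1) ?oner_eq0 //.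
  by elim/ord4_ind: (i) => /=; ring.
- by rewrite /= !inE negb_or !plane_M_neq.
Qed.

Lemma fifteen_planes_sub P : P \in planes ->
  is_plane_in P (zero_locus [:: q]).
Proof.
case/mem_fifteen_planes=> [[i [j [ij ->]]]|].
  split; first exact: dim_plane_Pi.
  move=> v; rewrite mem_plane_Pi => /andP[/eqP fi /eqP fj] v0.
  apply/zero_locusE; split=> //; move: fi fj ij; rewrite /cubic_quotient.
  by elim/ord4_ind: i; elim/ord4_ind: j => //= -> -> _; ring.
(* With a + b and c + d the two sums that equal t on the plane, the left side
   is the value of the cubic. *)
have pairing (a b c d t : K) : a + b = t -> c + d = t ->
    a * b * (c + d - t) + c * d * (a + b - t)
      - t * (a + b - t) * (c + d - t) = 0.
  by move=> -> ->; rewrite subrr !mulr0 subr0 addr0.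
rewrite !inE => /or3P[] /eqP-> ; (split; first by apply: dim_plane_M) => v;
  rewrite mem_plane_M => /andP[/eqP e1 /eqP e2] v0;
  apply/zero_locusE; split=> //;
  rewrite -[RHS](pairing _ _ _ _ _ e1 e2) /cubic_quotient; ring.
Qed.

(** * The equivalence with the Segre cubic *)

Definition segre_map : 'Hom('rV[K]_5, 'rV[K]_6) := forms_map (segre_coord h f).

Lemma segre_mapE v k :
  segre_map v 0 k = segre_coord (h v : K) (fun i => f i v : K) k.
Proof. by rewrite forms_mapE -[LHS]/(lfun_eval v _) raddf_segre_coord. Qed.

Lemma lker_segre_map : lker segre_map = 0%VS.
Proof.
apply/eqP; rewrite -subv0; apply/subvP=> v; rewrite memv_ker memv0 => /eqP L0.
have y0 k : segre_coord (h v : K) (fun i => f i v : K) k = 0.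
  by rewrite -segre_mapE L0 mxE.
have := y0 (rshift 4 ord_max); have := y0 (rshift 4 ord0).
rewrite !segre_coord_rshift /=; set e := \sum_(i < 4) _ => e1 e3.
have hv : h v = 0 :> K.
  apply: (mulfI char2); rewrite mulr0.
  transitivity ((e - h v) - (e - h v - h v - h v)); first by ring.
  by rewrite e3 e1 subrr.
apply/eqP/config_separates => // i; apply: (mulfI char2).
have := y0 (lshift 2 i); rewrite segre_coord_lshift -/e hv => yi.
rewrite mulr0; transitivity ((f i v + f i v - e + 0) + (e - h v)).
  by rewrite hv; ring.
by rewrite yi e1 addr0.
Qed.

Lemma limg_segre_map (y : 'rV[K]_6) :
  y \in limg segre_map <-> \sum_k y 0 k = 0.
Proof.
split=> [/memv_imgP[v _ ->]|].
  by under eq_bigr do rewrite segre_mapE; apply: segre_coord_sum.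
(* Inverting the coordinates: y4 - y5 = 2h, and y_i + y4 = 2 f_i for i < 4. *)
pose a := y 0 (rshift 4 ord0); pose b := y 0 (rshift 4 (lift ord0 ord0)).
pose S := \sum_(i < 4) y 0 (lshift 2 i).
have -> : \sum_k y 0 k = S + (a + b).
  rewrite (@big_split_ord _ _ _ 4 2); congr (_ + _).
  by rewrite big_ord_recl big_ord1.
rewrite addrA addrC => /eqP; rewrite addr_eq0 opprD => /eqP bE.
have [v [hv fv]] := config_point ((a - b) / 2%:R)
  (fun i => (y 0 (lshift 2 i) + a) / 2%:R).
have ev : \sum_i (f i v : K) = S / 2%:R + a + a.
  rewrite (eq_bigr _ (fun i _ => fv i)) -mulr_suml big_split /= -/S.
  by rewrite sumr_const card_ord -mulr_natr; field.
apply/memv_imgP; exists v; rewrite ?memvf //; apply/rowP=> k.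
rewrite segre_mapE; case: (@split_ordP 4 2 k) => i ->.
  by rewrite segre_coord_lshift ev hv fv bE; field.
rewrite segre_coord_rshift ev hv.
have [->|->] : i = ord0 \/ i = lift ord0 ord0.
- by case: (unliftP ord0 i) => [j|] ->; [right; rewrite [j]ord1|left].
- by rewrite -/a bE /=; field.
- by rewrite -/b bE /=; field.
Qed.

Lemma pullback_forms_map m n (l : 'I_m -> linform K n) (p : {mpoly K[m]}) :
  pullback (forms_map l) p = p \mPo [tuple form_poly (l i) | i < m].
Proof.
congr (_ \mPo _); apply: eq_from_tnth => i; rewrite !tnth_mktuple.
by apply: eq_bigr => j _; rewrite forms_mapE.
Qed.

Lemma pullback_segre_cubic :
  pullback segre_map (segre_cubic_eq K) = 24%:R *: q.
Proof.
rewrite pullback_forms_map /segre_cubic_eq raddf_sum /=.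
under eq_bigr => k _ do rewrite rmorphXn /= comp_mpolyXU -tnth_nth tnth_mktuple
  raddf_segre_coord.
by rewrite segre_coord_sum_cubes scaler_nat mulr_natl.
Qed.

Lemma segre_cubicE (y : 'rV[K]_6) : segre_cubic y <->
  [/\ y != 0, \sum_k y 0 k = 0 & \sum_k y 0 k ^+ 3 = 0].
Proof.
have E1 : (segre_hyperplane_eq K).@[y 0] = \sum_k y 0 k.
  by rewrite raddf_sum; apply: eq_bigr => k _; rewrite /= mevalXU.
have E3 : (segre_cubic_eq K).@[y 0] = \sum_k y 0 k ^+ 3.
  by rewrite raddf_sum; apply: eq_bigr => k _; rewrite /= rmorphXn /= mevalXU.
split=> [[y0 yP]|[y0 y1 y3]].
  by split=> //; rewrite -?E1 -?E3; apply: yP; rewrite !inE eqxx ?orbT.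
by split=> // p; rewrite !inE => /orP[] /eqP->; rewrite ?E1 ?E3.
Qed.

Lemma segre_map_cubes v : \sum_k segre_map v 0 k ^+ 3 = 24%:R * q.@[v 0].
Proof.
by rewrite meval_q -segre_coord_sum_cubes; under eq_bigr do rewrite segre_mapE.
Qed.

Lemma segre_map_equivalence : segre_equivalence q segre_map.
Proof.
have n24 : 24%:R != 0 :> K by rewrite (natrM _ 6 4) (natrM _ 2 2) !mulf_neq0.
split.
- exact: lker_segre_map.
- move=> y; rewrite limg_segre_map /segre_hyperplane_eq raddf_sum /=.
  by under [X in _ <-> X = _]eq_bigr do rewrite mevalXU.
- apply/seteqP; split=> [_ [v [v0 qv] <-]|y /segre_cubicE[y0 y1 y3]].
    apply/segre_cubicE; split.
    + by rewrite -(linear0 segre_map) (inj_eq (lker0P _)) // lker_segre_map.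
    + by apply/limg_segre_map; rewrite memv_img ?memvf.
    + by rewrite segre_map_cubes qv ?mulr0 ?mem_head.
  have /limg_segre_map/memv_imgP[v _ yE] := y1; exists v => //.
  split; first by apply: contraNneq y0 => v0; rewrite yE v0 linear0.
  move=> p; rewrite inE => /eqP->; apply: (mulfI n24).
  by rewrite -segre_map_cubes -yE y3 mulr0.
- by exists 24%:R; last exact: pullback_segre_cubic.
Qed.

(** * The planes contained in the cubic *)

Lemma plane_segre_pairing P : is_plane_in P (zero_locus [:: q]) ->
  exists sg : 'I_6 -> 'I_6, [/\ involutive sg, forall k, sg k != k
    & forall v, v \in P -> forall k,
        segre_coord (h v : K) (fun i => f i v : K) k
        + segre_coord (h v : K) (fun i => f i v : K) (sg k) = 0].
Proof.
move=> [dimP Pq].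
have dimW : \dim (segre_map @: P) = 3.
  by rewrite limg_dim_eq // lker_segre_map capv0.
have qP v : v \in P -> q.@[v 0] = 0.
  move=> vP; have [->|v0] := eqVneq v 0; last first.
    by apply: (Pq v vP v0).2; rewrite mem_head.
  by rewrite meval_q /cubic_quotient !linear0; ring.
have [|||sg [sgK sgN sgP]] :=
    @isotropic_subspace_involution K 3 (segre_map @: P)%VS char6.
- exact: dimW.
- move=> _ /memv_imgP[v vP ->]; apply/limg_segre_map.
  by rewrite memv_img ?memvf.
- by move=> _ /memv_imgP[v vP ->]; rewrite segre_map_cubes qP // mulr0.
exists sg; split=> // v vP k; rewrite -!segre_mapE.
by apply: sgP; rewrite memv_img.
Qed.

(** Restricted to P, each Segre coordinate is opposite to its partner.  The two
    coordinates y4 = e_1 - h and y5 = e_1 - 3h are exceptional; their partners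
    tell P apart. *)
Lemma plane_in_fifteen P : is_plane_in P (zero_locus [:: q]) -> P \in planes.
Proof.
move=> Pq; have [dimP _] := Pq.
have [sg [sgK sgN sgP]] := plane_segre_pairing Pq.
pose y4 : 'I_6 := rshift 4 (ord0 : 'I_2).
pose y5 : 'I_6 := rshift 4 (lift ord0 ord0 : 'I_2).
pose y i : 'I_6 := lshift 2 (i : 'I_4).
have kP (k : 'I_6) : [\/ exists i, k = y i, k = y4 | k = y5].
  case: (@split_ordP 4 2 k) => i ->; first by constructor 1; exists i.
  case: (unliftP ord0 i) => [j|] ->; last by constructor 2.
  by constructor 3; rewrite [j]ord1.
have [[i s4]|/eqP|s4] := kP (sg y4); last 2 first.
- by rewrite (negPf (sgN _)).
- have [[j s0]|s0|s0] := kP (sg (y o0)); last 2 first.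
  + by have := sgK (y o0); rewrite s0 s4.
  + by have := sgK (y o0); rewrite s0 -s4 sgK.
  have e2h v : v \in P -> \sum_i f i v = h v + h v :> K.
    move=> vP; have := sgP v vP y4; rewrite s4 !segre_coord_rshift /= => s45.
    apply: (mulfI char2); apply/eqP; rewrite -subr_eq0 -[X in _ == X]s45.
    by apply/eqP; ring.
  have f0j v : v \in P -> f o0 v + f j v = h v :> K.
    move=> vP; have := sgP v vP (y o0); rewrite s0 !segre_coord_lshift.
    rewrite e2h // => s0j; apply: (mulfI char2); apply/eqP.
    rewrite -subr_eq0 -[X in _ == X]s0j; apply/eqP; ring.
  have PM k l : \dim (plane_M h f o0 j k l) = 3 ->
      (forall v, \sum_i f i v = f o0 v + f j v + (f k v + f l v) :> K) ->
    P = plane_M h f o0 j k l.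
    move=> dimM sumM; apply: is_plane_eq => // v vP.
    rewrite mem_plane_M f0j // eqxx; apply/eqP/(addrI (h v : K)).
    by rewrite -e2h // sumM f0j.
  apply/mem_fifteen_planes; right; rewrite !inE.
  move: j s0 PM {f0j}; elim/ord4_ind => s0 PM.
  + by have := sgN (y o0); rewrite s0 eqxx.
  + rewrite (PM o2 o3) ?eqxx ?dim_plane_M // => v.
    by rewrite big_ord4 /=; ring.
  + rewrite (PM o1 o3) ?eqxx ?orbT ?dim_plane_M // => v.
    by rewrite big_ord4 /=; ring.
  + rewrite (PM o1 o2) ?eqxx ?orbT ?dim_plane_M // => v.
    by rewrite big_ord4 /=; ring.
have [[j s5]|s5|/eqP] := kP (sg y5); last 2 first.
- by have := sgK y5; rewrite s5 s4 => /eqP; rewrite (@eq_lrshift 4 2).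
- by rewrite (negPf (sgN _)).
apply/mem_fifteen_planes; left; exists i, j; split.
  by apply/eqP=> ij; have := sgK y5; rewrite s5 -ij -s4 sgK.
apply: is_plane_eq (dim_plane_Pi i j) _ => // v vP.
have := sgP v vP y4; have := sgP v vP y5; rewrite s4 s5.
rewrite !segre_coord_lshift !segre_coord_rshift /= => E5 E4.
rewrite mem_plane_Pi; apply/andP; split; apply/eqP/(mulfI char2).
  by rewrite mulr0 -[RHS]E4; ring.
by apply/eqP; rewrite -subr_eq0 -[X in _ == X]E5; apply/eqP; ring.
Qed.

(** Any equivalence is injective with image the hyperplane that contains the
    Segre cubic, so that each plane W of the Segre cubic is the image of its
    preimage, a plane of X. *)
Lemma image_planes (phi : 'Hom('rV[K]_5, 'rV[K]_6)) :
  segre_equivalence q phi ->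
  let images := [seq (phi @: P)%VS | P <- planes] in
  uniq images /\
  (forall W : {vspace 'rV[K]_6}, W \in images <-> is_plane_in W segre_cubic).
Proof.
move=> [ker_phi im_phi locus_phi _] images.
have inj_phi : lker phi == 0%VS by apply/eqP.
split.
  rewrite map_inj_uniq ?uniq_fifteen_planes // => P Q /eqP.
  by rewrite eq_limg_ker0 // => /eqP.
move=> W; split=> [/mapP[P /fifteen_planes_sub[dimP Pq] ->]|[dimW Wq]].
  split=> [|_ /memv_imgP[v vP ->] phiv0].
    by rewrite limg_dim_eq // ker_phi capv0.
  rewrite -locus_phi; exists v => //; apply: Pq => //.
  by apply: contraNneq phiv0 => ->; rewrite linear0.
have WE : W = (phi @: (phi @^-1: W))%VS.
  apply/esym; apply: lpreimK; apply/subvP=> y yW.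
  have [->|y0] := eqVneq y 0; first exact: mem0v.
  have [_] := Wq y yW y0; move=> /(_ (segre_hyperplane_eq K)) yh.
  by apply/im_phi/yh; rewrite mem_head.
apply/mapP; exists (phi @^-1: W)%VS => //; apply: plane_in_fifteen; split.
  by move: dimW; rewrite {1}WE limg_dim_eq // ker_phi capv0.
move=> v; rewrite -memv_preim => vW v0.
have : segre_cubic (phi v).
  by apply: Wq => //; rewrite -(linear0 phi) (inj_eq (lker0P inj_phi)).
by rewrite -locus_phi => -[w wq /(lker0P inj_phi) <-].
Qed.

End Configuration.

Theorem theorem5 (R : realType) (h : linform R[i] 5)
    (f g : 'I_4 -> linform R[i] 5)
    (hfg : forall i : 'I_4, h = f i + g i)
    (hgen : free (h :: [seq f i | i <- enum 'I_4])) :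
  let dvd_h (q : {mpoly R[i][5]}) :=
    form_poly h * q
      = \prod_(i < 4) form_poly (f i) - \prod_(i < 4) form_poly (g i) in
  (exists! q : {mpoly R[i][5]}, dvd_h q) /\
  (forall q : {mpoly R[i][5]}, dvd_h q ->
    let planes := fifteen_planes h f g in
    [/\ exists phi : 'Hom('rV[R[i]]_5, 'rV[R[i]]_6), segre_equivalence q phi,
        size planes = 15%N /\ uniq planes,
        forall P : {vspace 'rV[R[i]]_5},
          P \in planes <-> is_plane_in P (zero_locus [:: q])
      & forall phi : 'Hom('rV[R[i]]_5, 'rV[R[i]]_6), segre_equivalence q phi ->
          let images := [seq (phi @: P)%VS | P <- planes] in
          uniq images /\
          (forall W : {vspace 'rV[R[i]]_6},
             W \in images <-> is_plane_in W segre_cubic)]).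
Proof.
have char6 : 6%:R != 0 :> R[i] by rewrite Num.Theory.pnatr_eq0.
move=> dvd_h; have dvdE p : dvd_h p <-> _ := quotient_unique hfg hgen p.
split.
  by eexists; split=> [|p /dvdE->]; first exact/dvdE.
move=> p /dvdE-> planes; split.
- by exists (segre_map h f); apply: segre_map_equivalence.
- by split; [exact: size_fifteen_planes | exact: uniq_fifteen_planes].
- by move=> P; split; [apply: fifteen_planes_sub | apply: plane_in_fifteen].
- by move=> phi; apply: image_planes.
Qed.
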